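(* Let $S \subset \mathbb{Z}^d$ be a bounded set. Then $\beta_{\mathbb{Z}}(S) \leq 2^d$, and this bound is best possible (that is, for every $d$ there is a bounded set $S \subset \mathbb{Z}^d$ with $\beta_{\mathbb{Z}}(S) = 2^d$).
   Context: For a bounded set $S \subset \mathbb{Z}^d$, the lattice diameter is $\operatorname{diam}_{\mathbb{Z}}(S) := \max_{x,y \in S} |\operatorname{conv}(\{x,y\}) \cap \mathbb{Z}^d| - 1$. The lattice Borsuk number $\beta_{\mathbb{Z}}(S)$ is the minimal size (number of parts) of a partition of $S$ in which each part has lattice diameter strictly smaller than $\operatorname{diam}_{\mathbb{Z}}(S)$.
   Formalization: The upper bound excludes one-point sets S, which have lattice diameter 0 and no admissible partition, so their Borsuk number is undefined; sharpness is claimed for d ≥ 1, since no subset of Z^0 has Borsuk number 1. *)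

(* Defs.v *)
From mathcomp Require Import all_boot all_order all_algebra finmap.
From mathcomp Require Import boolp classical_sets cardinality reals ereal.
From mathcomp Require Import topology normedtype convex.

Set Implicit Arguments.
Unset Strict Implicit.
Unset Printing Implicit Defensive.

Import Order.TTheory GRing.Theory Num.Theory.
Import numFieldNormedType.Exports.

Local Open Scope classical_set_scope.
Local Open Scope ring_scope.

Definition lattice_embed (R : realType) (d : nat) (z : 'rV[int]_d) : 'rV[R]_d :=
  map_mx intr z.

Definition bounded_lattice_set (R : realType) (d : nat)
    (S : set 'rV[int]_d) : Prop :=
  [bounded lattice_embed R z | z in S].

Definition conv_hull (R : realType) (d : nat) (A : set 'rV[R]_d) :
    set 'rV[R]_d :=
  smallest (@convex_set R 'rV[R]_d) A.

Definition segment_lattice_points (R : realType) (d : nat)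
    (x y : 'rV[int]_d) : set 'rV[int]_d :=
  [set z | conv_hull [set lattice_embed R x; lattice_embed R y]
             (lattice_embed R z)].

(* Only meaningful for bounded (equivalently, finite) S: fset_set sends infinite
   sets to the empty one.  The truncated subtraction is harmless, as x is itself
   a lattice point of the segment.  On the empty set the value is 0. *)
Definition lattice_diam (R : realType) (d : nat) (S : set 'rV[int]_d) : nat :=
  (\max_(p <- fset_set (S `*` S))
     (#|` fset_set (segment_lattice_points R p.1 p.2)| - 1))%N.

Definition has_borsuk_partition (R : realType) (d : nat)
    (S : set 'rV[int]_d) (n : nat) : Prop :=
  exists F : nat -> set 'rV[int]_d,
    partition `I_n F S /\
    (forall i, (i < n)%N -> (lattice_diam R (F i) < lattice_diam R S)%N).

(* The infimum is a minimum as soon as one admissible partition exists; it is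
   +oo otherwise, which happens for a singleton (its lattice diameter is 0). *)
Definition lattice_borsuk_number (R : realType) (d : nat)
    (S : set 'rV[int]_d) : \bar R :=
  ereal_inf [set (n%:R)%:E | n in has_borsuk_partition R S].

(* Main.v *)
(* The lattice diameter of a pair {x, y} is the gcd of the coordinates of y - x.
   Let n > 0 be the diameter of S and colour x by the parities of the quotients
   floor(x_i / n): this uses at most 2^d colours.  If x and y had the same
   colour and y - x = n v, then floor(y_i / n) - floor(x_i / n) = v_i would be
   even for all i, so 2 n would divide the gcd of y - x; hence this gcd is not
   n.  Conversely, any two distinct points of {0,1}^d are at lattice distance 1,
   so every part of an admissible partition of the cube is a singleton. *)
Require Import Defs.
From mathcomp Require Import all_boot all_order all_algebra finmap.
From mathcomp Require Import boolp classical_sets cardinality reals ereal.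
From mathcomp Require Import topology normedtype convex.
From mathcomp Require Import zify ring lra.

Set Implicit Arguments.
Unset Strict Implicit.
Unset Printing Implicit Defensive.

Import Order.TTheory GRing.Theory Num.Theory.
Import numFieldNormedType.Exports.

Local Open Scope classical_set_scope.
Local Open Scope ring_scope.

(** * Lattice points of a segment, counted by a gcd *)

Lemma conv_hull2P (R : realType) (d : nat) (x y z : 'rV[R]_d) :
  conv_hull [set x; y] z <->
  exists2 t : R, 0 <= t <= 1 & z = x + t *: (y - x).
Proof.
split.
- apply: (@smallest_sub _ _ _
    [set z | exists2 t : R, 0 <= t <= 1 & z = x + t *: (y - x)]); last first.
    move=> _ [->|->].
      by exists 0; [rewrite lexx ler01|rewrite scale0r addr0].
    by exists 1; [rewrite lexx ler01|rewrite scale1r subrKC].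
  move=> a b l /set_mem[s /andP[s0 s1] ->] /set_mem[t /andP[t0 t1] ->].
  have l0 : 0 <= l%:num by [].
  have l1 : l%:num <= 1 by [].
  apply/mem_set; exists (l%:num * s + (1 - l%:num) * t).
    by apply/andP; split; nra.
  rewrite /conv/= /unstable.onem.
  by apply/rowP => i; rewrite !mxE; ring.
- move=> [t /andP[t0 t1] ->] A [cA xyA].
  (* The weight [t] goes to the first argument of [conv], hence [y] before [x]. *)
  have := cA y x (Itv01 t0 t1) (mem_set (xyA _ (or_intror erefl)))
    (mem_set (xyA _ (or_introl erefl))).
  move/set_mem; congr A.
  rewrite /conv/= /unstable.onem.
  by apply/rowP => i; rewrite !mxE; ring.
Qed.

(** The gcd of the coordinates, with value 0 at the zero vector. *)
Definition content (d : nat) (z : 'rV[int]_d) : nat :=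
  \big[gcdn/0%N]_(i < d) absz (z 0 i).

Lemma dvdn_content (d m : nat) (z : 'rV[int]_d) :
  (m %| content z)%N <-> exists w, z = m%:Z *: w.
Proof.
split=> [/dvdn_biggcdP mz|[w ->]].
  exists (\row_i (z 0%R i %/ m%:Z)%Z); apply/rowP => i; rewrite !mxE.
  by rewrite mulrC divzK// dvdzE; exact: mz.
by apply/dvdn_biggcdP => i _; rewrite mxE abszM dvdn_mulr.
Qed.

(** Integer combinations of the coordinates of [z] include 0 and, with a sign as coefficient, each
    [|z_i|]. By the identity for two integers they are closed under gcd. *)
Lemma content_Bezout (d : nat) (z : 'rV[int]_d) :
  exists a : 'I_d -> int, \sum_i a i * z 0 i = (content z)%:Z.
Proof.
apply: (big_ind (fun m : nat => exists a : 'I_d -> int, \sum_i a i * z 0 i = m%:Z)).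
- by exists (fun=> 0); rewrite big1// => i _; rewrite mul0r.
- move=> m n [a am] [b bn]; have [u [v uv]] := Bezoutz m n.
  exists (fun i => u * a i + v * b i).
  transitivity (u * m%:Z + v * n%:Z); last by rewrite uv.
  rewrite -am -bn !mulr_sumr -big_split; apply: eq_bigr => i _ /=.
  by rewrite mulrDl !mulrA.
- move=> i _; exists (fun j => (j == i)%:R * sgz (z 0 i)).
  rewrite (bigD1 i)//= eqxx mul1r big1 ?addr0; last first.
    by move=> j /negPf->; rewrite !mul0r.
  by rewrite abszEsg.
Qed.

Lemma content_eq0 (d : nat) (z : 'rV[int]_d) : content z = 0%N -> z = 0.
Proof.
move=> z0; have /dvdn_content[w ->] : (0 %| content z)%N by rewrite z0.
by rewrite scale0r.
Qed.

(** Cancelling the nonzero content in the Bezout relation of [z] leaves a relation with value 1 for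
    the quotient [v]. *)
Lemma content_primitive (d : nat) (z : 'rV[int]_d) : z <> 0 ->
  exists2 v, z = (content z)%:Z *: v &
    exists a : 'I_d -> int, \sum_i a i * v 0 i = 1.
Proof.
move=> /eqP z0.
have c0 : (content z)%:Z != 0.
  by apply: contraNN z0 => /eqP[/content_eq0->].
have /dvdn_content[v zv] := dvdnn (content z).
exists v => //; have [a az] := content_Bezout z; exists a.
apply: (mulfI c0); rewrite mulr1 -[RHS]az mulr_sumr; apply: eq_bigr => i _.
by rewrite [in RHS]zv mxE; ring.
Qed.

(* A Bezout relation for v forces the real parameter of a lattice point of the
   segment to be an integer. *)
Lemma segment_lattice_points_image (R : realType) (d g : nat)
    (x v : 'rV[int]_d) (a : 'I_d -> int) : \sum_i a i * v 0 i = 1 ->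
  segment_lattice_points R x (x + g%:Z *: v) =
  (fun k : nat => x + k%:Z *: v) @` `I_g.+1.
Proof.
move=> av; apply/seteqP; split=> [z /conv_hull2P[t /andP[t0 t1]]|_ [k /= kg <-]].
- move/rowP => zE.
  have zxE i : (z 0 i - x 0 i)%:~R = t * g%:R * (v 0 i)%:~R :> R.
    have := zE i; rewrite !mxE intrB => ->.
    by rewrite intrD intrM; ring.
  (* Applying the form [a] to [z - x = t g v] isolates [t g], and the result is an integer. *)
  pose K := \sum_i a i * (z 0 i - x 0 i).
  have KE : K%:~R = t * g%:R :> R.
    rewrite -[RHS]mulr1 -[X in _ * X](_ : 1%:~R = 1)// -av.
    rewrite /K !rmorph_sum mulr_sumr; apply: eq_bigr => i _.
    by rewrite /= intrM zxE intrM; ring.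
  have K0 : 0 <= K by rewrite -(ler0z R) KE mulr_ge0.
  have Kg : K <= g%:Z.
    by rewrite -(ler_int R) KE ler_piMl.
  exists `|K|%N; first by rewrite /=; lia.
  apply/rowP => i; rewrite !mxE gez0_abs//.
  apply/(@intr_inj R); rewrite intrD intrM KE -zxE intrB; ring.
(* For [g = 0] the quotient is 0 by convention, which fits since then [k = 0]. *)
- apply/conv_hull2P; exists (k%:R / g%:R).
    rewrite divr_ge0//=; have [->|g0] := posnP g; first by rewrite invr0 mulr0.
    by rewrite ler_pdivrMr ?ltr0n// mul1r ler_nat -ltnS.
  have kgE : k%:R / g%:R * g%:R = k%:R :> R.
    have [g0|g0] := posnP g; last by rewrite divfK// pnatr_eq0 -lt0n.
    by move: kg; rewrite g0 mulr0 ltnS leqn0 => /eqP->.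
  apply/rowP => i; rewrite !mxE !intrD !intrM.
  rewrite -[k%:~R]/(k%:R) -[g%:~R]/(g%:R) -{1}kgE; ring.
Qed.

Lemma card_segment_lattice_points (R : realType) (d : nat) (x y : 'rV[int]_d) :
  #|` fset_set (segment_lattice_points R x y)| = (content (y - x)).+1.
Proof.
(* A degenerate segment has no primitive direction and is counted separately. *)
have [->|yx] := pselect (y = x).
  have -> : content (x - x) = 0%N.
    by rewrite subrr /content big1// => i _; rewrite mxE.
  rewrite (_ : segment_lattice_points R x x = [set x]) ?fset_set1 ?cardfs1//.
  apply/seteqP; split=> z => [/conv_hull2P[t _]|->].
    rewrite subrr scaler0 addr0 => /rowP zx; apply/rowP => i.
    by have := zx i; rewrite !mxE => /intr_inj.
  by apply/conv_hull2P; exists 0; rewrite ?lexx ?ler01// scale0r addr0.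
have /content_primitive[v yxE [a av]] : y - x <> 0 by move/subr0_eq.
have yE : y = x + (content (y - x))%:Z *: v by rewrite -yxE subrKC.
rewrite [in LHS]yE (segment_lattice_points_image _ _ _ av).
apply/card_fset_set/inj_card_eq => k l _ _ /addrI/rowP kl.
(* The form [a] takes the value 1 on [v], so it recovers [k] from [k v]. *)
suff [] : k%:Z = l%:Z by [].
rewrite -[LHS]mulr1 -[RHS]mulr1 -av !mulr_sumr; apply: eq_bigr => i _.
by have := kl i; rewrite !mxE mulrCA => ->; rewrite mulrCA.
Qed.

(** * The lattice diameter as the largest content of a difference *)

Section lattice_diam.
Variables (R : realType) (d : nat) (S : set 'rV[int]_d).
Hypothesis finS : finite_set S.

Lemma content_le_lattice_diam (x y : 'rV[int]_d) :
  S x -> S y -> (content (y - x) <= lattice_diam R S)%N.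
Proof.
move=> Sx Sy; rewrite -[content _](subn1 _.+1).
rewrite -(card_segment_lattice_points R).
apply: (@leq_bigmax_seq _ _ _ 
  (fun p => #|` fset_set (segment_lattice_points R p.1 p.2)| - 1)%N (x, y)) => //.
by rewrite in_fset_set ?mem_set//; exact: finite_setX.
Qed.

Lemma lattice_diam_leP (n : nat) :
  (lattice_diam R S <= n)%N <->
  forall x y, S x -> S y -> (content (y - x) <= n)%N.
Proof.
split=> [Sn x y Sx Sy|Sn]; first exact: leq_trans (content_le_lattice_diam _ _) Sn.
apply/bigmax_leqP_seq => -[x y] + _.
rewrite in_fset_set; last exact: finite_setX.
by move=> /set_mem[/= Sx Sy]; rewrite card_segment_lattice_points subn1 Sn.
Qed.

End lattice_diam.

Lemma bounded_lattice_set_finite (R : realType) (d : nat)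
    (S : set 'rV[int]_d) : bounded_lattice_set R S -> finite_set S.
Proof.
move=> /pinfty_ex_gt0[M M0 SM].
have [N MN] : exists N : nat, M <= N%:R.
  by exists (Num.bound M); exact/ltW/archi_boundP/ltW.
(* Shifting the values [0..2N] by [N] reaches every point with coordinates in [[-N, N]]. *)
pose f (u : {ffun 'I_d -> 'I_N.*2.+1}) : 'rV[int]_d := \row_i ((u i)%:Z - N%:Z).
apply: (@sub_finite_set _ _ (f @` setT)); last exact/finite_image/finite_finset.
move=> z /SM/= zM.
have zN i : (`|z 0%R i| <= N)%N.
  rewrite -(ler_nat R) natr_absz; apply: le_trans MN; apply: le_trans zM.
  rewrite [leRHS]/Num.Def.normr/= mx_normrE.
  by apply: le_trans (le_bigmax _ _ (0, i)) => /=; rewrite mxE intr_norm.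
exists [ffun i => inord (absz (z 0 i + N%:Z))] => //.
apply/rowP => i; rewrite !mxE ffunE; move: (z 0 i) (zN i) => t tN.
by rewrite inordK; lia.
Qed.

(** * Upper bound by colouring *)

(** Parts must be nonempty and indexed by an initial segment of the naturals, so only the colours in
    use are kept, numbered by their position in [enum U]. *)
Lemma has_borsuk_partition_coloring (R : realType) (d : nat) (C : finType)
    (S : set 'rV[int]_d) (c : 'rV[int]_d -> C) :
  (forall k, (lattice_diam R (S `&` c @^-1` [set k]) < lattice_diam R S)%N) ->
  exists2 m, (m <= #|C|)%N & has_borsuk_partition R S m.
Proof.
move=> cS; pose U := [set k | `[< exists2 x, S x & c x = k >]]%SET.
have cU x : S x -> c x \in enum U.
  by move=> Sx; rewrite mem_enum inE; apply/asboolP; exists x.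
exists #|U|; first exact: max_card.
pose F i := S `&` [set x | index (c x) (enum U) = i].
have FE k : (k < #|U|)%N -> exists2 e, e \in U & F k = S `&` c @^-1` [set e].
  move=> kU; pose o := Ordinal kU; pose e := enum_val o.
  have eE : e = nth e (enum U) k by exact: enum_val_nth.
  exists e; first exact: enum_valP.
  apply/seteqP; split=> x [Sx] /= cx; split=> //=.
    by rewrite eE -cx nth_index// cU.
  by rewrite cx eE index_uniq ?enum_uniq// -cardE.
exists F; split; last by move=> k /FE[e _ ->].
split.
- apply/seteqP; split=> [x [k _ []]//|x Sx].
  by exists (index (c x) (enum U)) => //=; rewrite cardE index_mem cU.
- by move=> i j _ _ [x [[_ <-] [_ <-]]].
- move=> k /FE[e + ->]; rewrite inE => /asboolP[x Sx xe].
  by exists x.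
Qed.

Lemma has_borsuk_partition_le_exp (R : realType) (d : nat)
    (S : set 'rV[int]_d) : finite_set S -> (forall x, S <> [set x]) ->
  exists2 m, (m <= 2 ^ d)%N & has_borsuk_partition R S m.
Proof.
move=> finS S1; set n := lattice_diam R S.
have [S0|/set0P[x0 Sx0]] := eqVneq S set0.
  (* The empty set is partitioned into no parts at all, so no strict inequality has to hold. *)
  exists 0%N => //; exists (fun=> set0); split=> //; split=> //.
  by rewrite S0; apply/seteqP; split=> x // [i].
have n0 : (0 < n)%N.
  rewrite lt0n; apply/eqP => n0; apply: (S1 x0); apply/seteqP.
  split=> [x Sx|_ ->//]; apply/subr0_eq/content_eq0/eqP.
  by rewrite -leqn0 -[leqRHS]n0 content_le_lattice_diam.
have [|m] := @has_borsuk_partition_coloring R d {ffun 'I_d -> bool} S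
    (fun x => [ffun i => (2 %| x 0%R i %/ n%:Z)%Z]); last first.
  by rewrite card_ffun card_ord card_bool; exists m.
move=> k; apply: (@leq_ltn_trans n.-1); last by rewrite ltn_predL.
apply/(lattice_diam_leP R (finite_setIl _ finS)) => x y [Sx xk] [Sy yk].
rewrite -ltnS (ltn_predK n0) ltn_neqAle content_le_lattice_diam// andbT.
apply/eqP => yxn.
have /dvdn_content[v yxv] : (n %| content (y - x))%N by rewrite yxn.
have yE i : y 0 i = v 0 i * n%:Z + x 0 i.
  by have /rowP/(_ i) := yxv; rewrite !mxE mulrC => <-; rewrite subrK.
(* Adding [v_i n] to a coordinate shifts its quotient by exactly [v_i]. *)
have /dvdn_content[w vw] : (2 %| content v)%N.
  apply/dvdn_biggcdP => i _.
  have /ffunP/(_ i) := etrans xk (esym yk); rewrite !ffunE yE divzMDl; last by rewrite -lt0n.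
  move: (v 0 i) (x 0%R i %/ n)%Z => a b; lia.
have : ((n * 2)%N %| content (y - x))%N.
  by apply/dvdn_content; exists w; rewrite yxv vw scalerA PoszM.
by rewrite yxn => /dvdn_leq; lia.
Qed.

(** * The cube attains the bound *)

Definition unit_cube (d : nat) : set 'rV[int]_d :=
  range (fun u : {ffun 'I_d -> bool} => \row_i (u i : nat)%:Z).
Arguments unit_cube : clear implicits.

Lemma bounded_unit_cube (R : realType) (d : nat) :
  bounded_lattice_set R (unit_cube d).
Proof.
exists 1; split=> // M /ltW M1 _ [u _ <-] /=; apply: le_trans M1.
rewrite [leLHS]/Num.Def.normr/= mx_normrE; apply: bigmax_le => // i _.
by rewrite !mxE; case: (u _); rewrite ?normr1 ?normr0.
Qed.

Lemma lattice_diam_unit_cube (R : realType) (d : nat) :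
  (lattice_diam R (unit_cube d) <= 1)%N.
Proof.
apply/(lattice_diam_leP R (bounded_lattice_set_finite (bounded_unit_cube R d))).
move=> _ _ [u _ <-] [v _ <-].
have [->|/eqP uv] := eqVneq u v.
  by rewrite subrr /content big1// => i _; rewrite mxE.
have [i uvi] : exists i, u i <> v i.
  by apply/existsNP => uvE; apply/uv/ffunP.
(* A coordinate where the vertices differ contributes 1 to the gcd. *)
apply: dvdn_leq => //; apply: (biggcdn_inf i) => //.
by rewrite !mxE; move: uvi; case: (u i) (v i) => -[].
Qed.

(** Each part has diameter 0, so the map from a vertex to the index of its part is injective. *)
Lemma unit_cube_partition_ge (R : realType) (d n : nat) :
  has_borsuk_partition R (unit_cube d) n -> (2 ^ d <= n)%N.
Proof.
move=> [F [[FS _ _] Fdiam]].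
have finS := bounded_lattice_set_finite (bounded_unit_cube R d).
pose q (u : {ffun 'I_d -> bool}) : 'rV[int]_d := \row_i (u i : nat)%:Z.
have part u : exists i : 'I_n, F i (q u).
  have : unit_cube d (q u) by exists u.
  by rewrite -FS => -[i /= ni Fi]; exists (Ordinal ni).
have [c cF] := choice part.
have -> : (2 ^ d = #|{ffun 'I_d -> bool}|)%N.
  by rewrite card_ffun card_bool card_ord.
rewrite -[n]card_ord; apply: (leq_card c) => u v cuv.
have finF : finite_set (F (c u)).
  by apply: sub_finite_set finS; rewrite -FS => x Fx; exists (c u) => /=.
have /(lattice_diam_leP R finF)/(_ (q u) (q v) (cF u)) :
    (lattice_diam R (F (c u)) <= 0)%N.
  by rewrite -ltnS; apply: leq_trans (lattice_diam_unit_cube R d); exact: Fdiam.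
rewrite {1}cuv => /(_ (cF v)); rewrite leqn0 => /eqP/content_eq0/subr0_eq/rowP quv.
apply/ffunP => i; have := quv i; rewrite !mxE => -[].
by case: (u i) (v i) => -[].
Qed.

(** The all-zeros and all-ones vertices differ once there is a coordinate; in dimension 0 the cube
    is a point. *)
Lemma unit_cube_neq_set1 (d : nat) (x : 'rV[int]_d) :
  (0 < d)%N -> unit_cube d <> [set x].
Proof.
case: d x => // d x _ cubeE.
have cubex (b : bool) : \row_(i < d.+1) (b : nat)%:Z = x.
  have : unit_cube d.+1 (\row_(i < d.+1) (b : nat)%:Z).
    by exists [ffun=> b] => //; apply/rowP => i; rewrite !mxE ffunE.
  by rewrite cubeE.
by have /rowP/(_ ord0) := etrans (cubex true) (esym (cubex false)); rewrite !mxE.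
Qed.

(** A singleton has diameter 0, hence no admissible partition and the value [+oo]. In dimension 0
    the only other set is empty, with value 0, so [2 ^ 0] is not attained there. *)
Theorem theorem4p8 (R : realType) (d : nat) :
  (forall S : set 'rV[int]_d,
      bounded_lattice_set R S ->
      (forall x : 'rV[int]_d, S <> [set x]) ->
      (lattice_borsuk_number R S <= ((2 ^ d)%:R)%:E)%E) /\
  ((0 < d)%N ->
    exists S : set 'rV[int]_d,
      bounded_lattice_set R S /\
      lattice_borsuk_number R S = ((2 ^ d)%:R)%:E).
Proof.
have upper (S : set 'rV[int]_d) : bounded_lattice_set R S ->
    (forall x, S <> [set x]) -> (lattice_borsuk_number R S <= ((2 ^ d)%:R)%:E)%E.
  move=> /bounded_lattice_set_finite finS S1.
  have [m md Sm] := has_borsuk_partition_le_exp R finS S1.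
  by apply: ge_ereal_inf; exists (m%:R)%:E; [exists m|rewrite lee_fin ler_nat].
split=> // d0; exists (unit_cube d); split; first exact: bounded_unit_cube.
apply/eqP; rewrite eq_le; apply/andP; split.
  apply: upper => [|x]; first exact: bounded_unit_cube.
  exact: unit_cube_neq_set1.
apply: le_ereal_inf_tmp => _ [n Sn <-].
by rewrite lee_fin ler_nat; exact: unit_cube_partition_ge Sn.
Qed.
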